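(* Let $n\geq 1$ and let $C_{2n+1}$ be the cycle on $2n+1$ vertices. Then the Lanzhou spectrum of $C_{2n+1}$ consists of $8(2n-2)$ with multiplicity $1$, and $8(2n-2)\cos\frac{2\pi j}{2n+1}$ with multiplicity $2$ for each $j=1,\ldots,n$ (multiplicities being added if values coincide).
   Context: Graphs are finite, simple and undirected. For a graph $G$ on $N$ vertices, $d_G(u)$ is the degree of $u$ in $G$ and $d_{\overline{G}}(u)=N-1-d_G(u)$ is its degree in the complement $\overline{G}$. The Lanzhou matrix $A_{Lz}(G)$ is the real symmetric $N\times N$ matrix indexed by vertices whose $(u,v)$ entry is $d_G(u)d_{\overline{G}}(u)+d_G(v)d_{\overline{G}}(v)$ if $u$ and $v$ are adjacent in $G$, and $0$ otherwise. The Lanzhou spectrum of $G$ is the multiset of eigenvalues of $A_{Lz}(G)$. *)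

(* Defs.v *)
From HB Require Import structures.
From mathcomp Require Import all_boot all_order all_algebra.
From mathcomp Require Import polyrcf.
From mathcomp Require Import reals trigo.

Set Implicit Arguments.
Unset Strict Implicit.
Unset Printing Implicit Defensive.

Import Order.TTheory GRing.Theory Num.Theory.
Local Open Scope ring_scope.

Record sgraph (N : nat) := SGraph {
  adj : rel 'I_N;
  adj_sym : symmetric adj;
  adj_irr : irreflexive adj
}.

Definition compl_adj N (G : sgraph N) : rel 'I_N :=
  fun u v => (u != v) && ~~ adj G u v.

Lemma compl_adj_sym N (G : sgraph N) : symmetric (compl_adj G).
Proof. by move=> u v; rewrite /compl_adj eq_sym adj_sym. Qed.

Lemma compl_adj_irr N (G : sgraph N) : irreflexive (compl_adj G).
Proof. by move=> u; rewrite /compl_adj eqxx. Qed.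

Definition compl N (G : sgraph N) : sgraph N :=
  SGraph (@compl_adj_sym N G) (@compl_adj_irr N G).

Definition deg N (G : sgraph N) (u : 'I_N) : nat := #|[set v | adj G u v]|.

Lemma deg_compl N (G : sgraph N) (u : 'I_N) :
  deg (compl G) u = (N - 1 - deg G u)%N.
Proof.
have := cardsC [set v | adj G u v]; rewrite card_ord => EN.
have -> : deg (compl G) u = #|(~: [set v | adj G u v]) :\ u|.
  by apply: eq_card => v; rewrite !inE /= /compl_adj eq_sym.
have := cardsD1 u (~: [set v | adj G u v]).
rewrite !inE adj_irr /= /deg add1n => Ec.
by move: EN; rewrite Ec addnS => EN; rewrite -[X in (X - 1)%N]EN subn1 /= addKn.
Qed.

Definition lanzhou_matrix (R : pzRingType) N (G : sgraph N) : 'M[R]_N :=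
  \matrix_(u, v) if adj G u v
                 then (deg G u * deg (compl G) u
                       + deg G v * deg (compl G) v)%:R
                 else 0.

(* Multisets are sequences up to [perm_eq].  Only eigenvalues in R are listed;
   for a symmetric real matrix these are all of them. *)
Definition spectrum (R : rcfType) N (A : 'M[R]_N) : seq R :=
  flatten [seq nseq (mup x (char_poly A)) x | x <- rootsR (char_poly A)].

Lemma count_spectrum (R : rcfType) N (A : 'M[R]_N) (x : R) :
  count_mem x (spectrum A) = mup x (char_poly A).
Proof.
have p0 : char_poly A != 0 by rewrite monic_neq0 ?char_poly_monic.
rewrite /spectrum count_flatten -map_comp sumnE big_map.
under eq_bigr => y _ do rewrite /= count_nseq /=.
have [xr|xr] := boolP (x \in rootsR (char_poly A)).
  rewrite (bigD1_seq x) ?uniq_roots //= eqxx mul1n big1 ?addn0 // => y /negbTE.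
  by move=> ->; rewrite mul0n.
rewrite big1_seq => [|y /andP[_ yr]]; last first.
  by case: eqP yr xr => [->->|_ _ _] //; rewrite mul0n.
by symmetry; apply: mupNroot; move: xr; rewrite -(roots_on_rootsR p0) in_itv.
Qed.

Definition lanzhou_spectrum (R : rcfType) N (G : sgraph N) : seq R :=
  spectrum (lanzhou_matrix R G).

(* [ordS] is the successor modulo N.  The condition [u != v] only matters for
   N = 1; the graph is the cycle on N vertices when N >= 3. *)
Definition cycle_adj N : rel 'I_N :=
  fun u v => (u != v) && ((v == ordS u) || (u == ordS v)).

Lemma cycle_adj_sym N : symmetric (@cycle_adj N).
Proof. by move=> u v; rewrite /cycle_adj eq_sym orbC. Qed.

Lemma cycle_adj_irr N : irreflexive (@cycle_adj N).
Proof. by move=> u; rewrite /cycle_adj eqxx. Qed.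

Definition cycle_graph N : sgraph N :=
  SGraph (@cycle_adj_sym N) (@cycle_adj_irr N).

(* Main.v *)
(* The rows (cos (j k w) + sin (j k w))_k, w = 2 pi / N, of the discrete Hartley
   transform are real eigenvectors of every matrix c (S + S^-1), S the cyclic
   shift, with eigenvalues 2 c cos (j w).  The Hartley matrix squares to N, so it
   is invertible and the characteristic polynomial splits accordingly; the
   Lanzhou matrix of the N-cycle is of this form with c = 4 (N - 3). *)
Require Import Defs.
From HB Require Import structures.
From mathcomp Require Import all_boot all_order all_algebra.
From mathcomp Require Import polyrcf.
From mathcomp Require Import reals trigo.
From mathcomp Require Import ring lra zify.

Import Order.TTheory GRing.Theory Num.Theory.
Local Open Scope ring_scope.

(** Over the polynomials, [P] intertwines [X - A] and [X - D]; take determinants and cancel the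
    nonzero constant [\det P]. *)
Lemma char_poly_conj (F : fieldType) (N : nat) (P A D : 'M[F]_N) :
  P \in unitmx -> P *m A = D *m P -> char_poly A = char_poly D.
Proof.
move=> Pu PA.
have Pn0 : \det (map_mx polyC P) != 0.
  by rewrite det_map_mx polyC_eq0 -unitfE -unitmxE.
apply: (mulfI Pn0); rewrite mulrC [RHS]mulrC /char_poly.
rewrite mulrC -!det_mulmx; congr (\det _).
by rewrite /char_poly_mx mulmxBr mulmxBl -!map_mxM PA scalar_mxC.
Qed.

(** [1 - cos x] is [2 sin^2 (|x| / 2)], and sine is positive on the open interval from [0] to
    [pi]. *)
Lemma cos_neq1 (R : realType) (x : R) : 0 < `|x| < pi *+ 2 -> cos x != 1.
Proof.
move=> /andP[x0 x2].
have -> : cos x = cos ((`|x| / 2) *+ 2).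
  rewrite -mulr_natr divfK ?pnatr_eq0 //.
  by case: (ger0P x) => _; rewrite ?cosN.
rewrite cos_mulr2n cos2sin2.
have s0 : 0 < sin (`|x| / 2).
  by apply: sin_gt0_pi; move: x2; rewrite mulr2n => x2; apply/andP; split; lra.
have := exprn_gt0 2 s0; rewrite mulr2n => s2.
by apply/eqP; lra.
Qed.

(** * Sums of cosines and sines over a full period *)

Section FullPeriod.
Variables (R : realType) (N : nat) (x : R).
Hypotheses (cosN1 : cos (x *+ N) = 1) (sinN0 : sin (x *+ N) = 0).

Lemma cos_sin_full_period (y : R) :
  (cos (y + x *+ N) = cos y) * (sin (y + x *+ N) = sin y).
Proof. by split; rewrite ?cosD ?sinD cosN1 sinN0; ring. Qed.

Lemma cos_sin_modn (m : nat) :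
  (cos (x *+ (m %% N)) = cos (x *+ m)) * (sin (x *+ (m %% N)) = sin (x *+ m)).
Proof.
rewrite [in X in (_ = cos X)](divn_eq m N) [in X in (_ = sin X)](divn_eq m N).
elim: (m %/ N)%N => [|q IHq]; first by rewrite mul0n add0n.
have -> : (q.+1 * N + m %% N = (q * N + m %% N) + N)%N by lia.
by rewrite mulrnDr !cos_sin_full_period !IHq.
Qed.

Let C := \sum_(k < N) cos (x *+ k).
Let S := \sum_(k < N) sin (x *+ k).

Lemma sum_shift (f : R -> R) : f (x *+ N) = f 0 ->
  \sum_(k < N) f (x *+ k + x) = \sum_(k < N) f (x *+ k).
Proof.
move=> fN; apply/eqP; rewrite -subr_eq0 -sumrB.
under eq_bigr do rewrite -mulrSr.
rewrite -(big_mkord xpredT (fun k => f (x *+ k.+1) - f (x *+ k))).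
by rewrite telescope_sumr // fN mulr0n subrr.
Qed.

(** Together with [shiftS]: the vector [(C, S)] is fixed by the rotation of angle [x]. *)
Let shiftC : C = cos x * C - sin x * S.
Proof.
rewrite -[LHS](sum_shift cos) ?cosN1 ?cos0 //.
by rewrite !mulr_sumr -sumrB; apply: eq_bigr => k _; rewrite cosD; ring.
Qed.

Let shiftS : S = cos x * S + sin x * C.
Proof.
rewrite -[LHS](sum_shift sin) ?sinN0 ?sin0 //.
by rewrite !mulr_sumr -big_split; apply: eq_bigr => k _ /=; rewrite sinD; ring.
Qed.

Lemma sum_cos_full_period : cos x != 1 -> C = 0.
Proof.
(* This is the determinant of the identity minus the rotation; its being nonzero forces
   [(C, S) = 0]. *)
move=> c1; have cB : (1 - cos x) ^+ 2 + sin x ^+ 2 != 0.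
  rewrite paddr_eq0 ?sqr_ge0 // negb_and expf_neq0 //.
  by rewrite subr_eq0 eq_sym.
apply: (mulfI cB).
have e1 : (1 - cos x) * C = - sin x * S by rewrite mulrBl mul1r {1}shiftC; ring.
have e2 : (1 - cos x) * S = sin x * C by rewrite mulrBl mul1r {1}shiftS; ring.
rewrite mulr0 mulrDl expr2 -mulrA e1 mulrCA e2; ring.
Qed.

(** If [cos x = 1] then [sin x = 0] and every term vanishes; otherwise [C = 0], and [shiftS] gives
    [S = 0]. *)
Lemma sum_sin_full_period : S = 0.
Proof.
have [c1|c1] := eqVneq (cos x) 1.
  have s0 : sin x = 0.
    by apply/eqP; rewrite -sqrf_eq0 sin2cos2 c1 expr1n subrr.
  rewrite /S big1 // => k _; elim: (k : nat) => [|m IH].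
    by rewrite mulr0n sin0.
  by rewrite mulrSr sinD IH s0 c1; ring.
have e2 : (1 - cos x) * S = sin x * C by rewrite mulrBl mul1r {1}shiftS; ring.
have c0 : 1 - cos x != 0 by rewrite subr_eq0 eq_sym.
by apply: (mulfI c0); rewrite e2 sum_cos_full_period // !mulr0.
Qed.

End FullPeriod.

(** * The discrete Hartley transform and matrices it diagonalises *)

Section Hartley.
Variables (R : realType) (N : nat).
Hypothesis N_gt0 : (0 < N)%N.

Definition freq (j : nat) : R := 2 * pi * j%:R / N%:R.

Definition cas (x : R) : R := cos x + sin x.

Definition hartley : 'M[R]_N := \matrix_(j, k) cas (freq j *+ k).

Lemma cos_sin_2piM (j : nat) :
  (cos (pi *+ 2 *+ j) = 1 :> R) * (sin (pi *+ 2 *+ j) = 0 :> R).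
Proof.
elim: j => [|j [IHc IHs]]; first by rewrite mulr0n cos0 sin0.
by rewrite mulrSr cosD2pi sinD2pi.
Qed.

Lemma freqMN (j : nat) : freq j *+ N = pi *+ 2 *+ j.
Proof.
have N0 : N%:R != 0 :> R by rewrite pnatr_eq0 -lt0n.
rewrite -[LHS]mulr_natr divfK // -[RHS]mulr_natr -[in RHS](mulr_natl pi 2) //.
Qed.

Lemma freqE (j k : nat) : freq j *+ k = freq k *+ j.
Proof. by rewrite -[LHS]mulr_natr -[RHS]mulr_natr /freq; ring. Qed.

(** Removes the reduction modulo [N] that [ordS] and [ord_pred] put on column indices. *)
Lemma cas_modn (j m : nat) : cas (freq j *+ (m %% N)) = cas (freq j *+ m).
Proof.
by rewrite /cas !cos_sin_modn ?freqMN ?cos_sin_2piM.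
Qed.

Lemma casM (x y : R) : cas x * cas y = cos (x - y) + sin (x + y).
Proof. by rewrite /cas cosB sinD; ring. Qed.

Lemma cas_shift (x y : R) : cas (x + y) + cas (x - y) = 2 * cos y * cas x.
Proof. by rewrite /cas cosB cosD sinB sinD; ring. Qed.

Lemma hartley_sqr : hartley *m hartley = (N%:R)%:M.
Proof.
apply/matrixP => j l; rewrite !mxE.
(* [freqE] moves the summation index [k] into the multiplier, so each entry splits into a cosine sum
   at the difference of two frequencies and a sine sum at their sum. *)
under eq_bigr => k _ do
  rewrite !mxE (freqE k) casM -mulrnBl -mulrnDl.
rewrite big_split /= sum_sin_full_period; last 2 first.
- by rewrite mulrnDl !freqMN cosD !cos_sin_2piM; ring.
- by rewrite mulrnDl !freqMN sinD !cos_sin_2piM; ring.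
rewrite addr0; have [<-|jl] := eqVneq j l.
  under eq_bigr do rewrite subrr mul0rn cos0.
  by rewrite sumr_const card_ord mulr1n.
rewrite sum_cos_full_period ?mulr0n //.
- by rewrite mulrnBl !freqMN cosB !cos_sin_2piM; ring.
- by rewrite mulrnBl !freqMN sinB !cos_sin_2piM; ring.
(* The angle is [2 pi (j - l) / N] with [0 < |j - l| < N]. *)
apply: cos_neq1.
have -> : freq j - freq l = (pi *+ 2) * ((j%:R - l%:R) / N%:R).
  by rewrite /freq -[pi *+ 2]mulr_natl; ring.
have pi2 : 0 < pi *+ 2 :> R by rewrite pmulrn_lgt0 // pi_gt0.
have NR : 0 < N%:R :> R by rewrite ltr0n.
rewrite normrM (gtr0_norm pi2) pmulr_rgt0 // normr_gt0 gtr_pMr //.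
rewrite mulf_neq0 ?invr_eq0 ?(gt_eqF NR) ?subr_eq0 ?eqr_nat //=.
rewrite normrM normfV (gtr0_norm NR) ltr_pdivrMr // mul1r ltr_norml.
have := ltn_ord j; have := ltn_ord l; rewrite -!(ltr_nat R) => lN jN.
have := ler0n R j; have := ler0n R l => l0 j0.
by apply/andP; split; lra.
Qed.

Lemma hartley_unit : hartley \in unitmx.
Proof.
have N0 : N%:R != 0 :> R by rewrite pnatr_eq0 -lt0n.
apply: (proj1 (@mulmx1_unit _ _ _ (N%:R^-1 *: hartley) _)).
by rewrite -scalemxAr hartley_sqr scale_scalar_mx mulVf.
Qed.

Lemma hartley_shift (j v : 'I_N) :
  hartley j (ordS v) + hartley j (ord_pred v) =
  2 * cos (freq j) * hartley j v.
Proof.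
rewrite !mxE /= !cas_modn -cas_shift mulrSr; congr (_ + _).
(* [ord_pred v] is [(v + N).-1] modulo [N]; the added [N] avoids truncation at [v = 0] and
   contributes only a full period. *)
have -> : (v + N).-1 = (v + N - 1)%N by lia.
have -> : freq j *+ (v + N - 1) = freq j *+ v - freq j + freq j *+ N.
  by rewrite mulrnBr ?addn_gt0 ?N_gt0 ?orbT // mulrnDr; ring.
by rewrite /cas !cos_sin_full_period ?freqMN ?cos_sin_2piM.
Qed.

(** The hypothesis encodes [A = c (S + S^-1)] by its action on row vectors [f]; it is applied to the
    rows of [hartley]. *)
Lemma char_poly_circulant (A : 'M[R]_N) (c : R) :
  (forall f : 'I_N -> R, forall v,
     \sum_u f u * A u v = c * (f (ordS v) + f (ord_pred v))) ->
  char_poly A = \prod_(j < N) ('X - (2 * c * cos (freq j))%:P).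
Proof.
move=> AE; pose D : 'M[R]_N := diag_mx (\row_j (2 * c * cos (freq j))).
rewrite (@char_poly_conj _ _ _ _ D hartley_unit); last first.
  apply/matrixP => j v; rewrite mul_diag_mx !mxE AE hartley_shift !mxE; ring.
rewrite char_poly_trig ?diag_mx_is_trig //.
by apply: eq_bigr => j _; rewrite !mxE eqxx.
Qed.

End Hartley.

(** * Neighbours, degrees and Lanzhou matrix of the cycle *)

Section Cycle.
Variable N : nat.
Hypothesis N_ge3 : (3 <= N)%N.

Lemma ordS_neq (u : 'I_N) : ordS u != u.
Proof.
rewrite -val_eqE /=; have uN := ltn_ord u.
have [uS|uS] := ltnP u.+1 N; first by rewrite modn_small //; lia.
have -> : u.+1 = N by lia.
by rewrite modnn; lia.
Qed.

(** Applying [ordS] to both sides, this says that [u + 2] and [u] differ modulo [N], which holds as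
    [N >= 3]. *)
Lemma ordS_neq_pred (u : 'I_N) : ordS u != ord_pred u.
Proof.
rewrite -(inj_eq (@ordS_inj N)) ord_predK -val_eqE /=.
have uN := ltn_ord u; rewrite -addn1 modnDml addn1.
have [uS|uS] := ltnP u.+2 N; first by rewrite modn_small //; lia.
by rewrite -(subnK uS) modnDr modn_small; lia.
Qed.

Lemma cycle_adjE (u v : 'I_N) :
  adj (cycle_graph N) u v = (u \in [set ordS v; ord_pred v]).
Proof.
rewrite !inE /= /cycle_adj.
have -> : (v == ordS u) = (u == ord_pred v).
  by apply/eqP/eqP => ->; rewrite ?ordSK ?ord_predK.
rewrite orbC; have [->|_ //] := eqVneq u v.
rewrite eq_sym (negbTE (ordS_neq v)) -(inj_eq (@ordS_inj N)) ord_predK.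
by rewrite (negbTE (ordS_neq v)).
Qed.

Lemma deg_cycle (u : 'I_N) : deg (cycle_graph N) u = 2%N.
Proof.
have <- : #|[set ordS u; ord_pred u]| = 2%N by rewrite cards2 ordS_neq_pred.
by apply: eq_card => v; rewrite inE adj_sym cycle_adjE.
Qed.

Lemma char_poly_lanzhou_cycle (R : realType) :
  char_poly (lanzhou_matrix R (cycle_graph N)) =
  \prod_(j < N) ('X - (8 * (N - 3)%:R * cos (freq R N j))%:P).
Proof.
have N0 : (0 < N)%N by lia.
(* All degrees are [2] and all complement degrees [N - 3], so adjacent vertices have entry
   [2 (N - 3) + 2 (N - 3)]. *)
rewrite (@char_poly_circulant _ _ N0 _ (4 * (N - 3)%:R)).
  by apply: eq_bigr => j _; congr (_ - _%:P); ring.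
move=> f v; under eq_bigr => u _.
  rewrite mxE cycle_adjE !deg_compl !deg_cycle -!subnDA /=.
  rewrite (fun_if (fun z => f u * z)) mulr0; over.
rewrite -big_mkcond /= big_setU1 ?inE ?ordS_neq_pred // big_set1.
by rewrite /= addnn -muln2 !natrM; ring.
Qed.

End Cycle.

(** Separates the two copies, so that one can be matched with the indices [1..n] and the other with
    [n+1..2n]. *)
Lemma perm_flatten_nseq2 (T : eqType) (I : Type) (f : I -> T) (s : seq I) :
  perm_eq (flatten [seq nseq 2 (f i) | i <- s])
          ([seq f i | i <- s] ++ [seq f i | i <- s]).
Proof.
elim: s => //= i s IHs; rewrite perm_cons perm_sym perm_catC /= perm_cons.
by rewrite perm_sym.
Qed.

(** The two angles add up to [2 pi]. This pairing of [j] with [N - j] is the source of the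
    multiplicity [2]. *)
Lemma cos_freq_rev (R : realType) (N j : nat) : (0 < N)%N -> (j <= N)%N ->
  cos (freq R N (N - j)) = cos (freq R N j).
Proof.
move=> N0 jN; have N0R : N%:R != 0 :> R by rewrite pnatr_eq0 -lt0n.
have -> : freq R N (N - j) = - freq R N j + pi *+ 2.
  by rewrite /freq natrB // -mulr_natl; field.
by rewrite cosD2pi cosN.
Qed.

Theorem theorem31 (R : realType) (n : nat) (hn : (1 <= n)%N) :
  perm_eq
    (lanzhou_spectrum R (cycle_graph (2 * n + 1)))
    (8 * (2 * n%:R - 2)
     :: flatten [seq nseq 2 (8 * (2 * n%:R - 2)
                             * cos (2 * pi * j%:R / (2 * n + 1)%:R))
                | j <- iota 1 n]).
Proof.
have N3 : (3 <= 2 * n + 1)%N by lia.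
pose lam j : R := 8 * (2 * n%:R - 2) * cos (freq R (2 * n + 1) j).
have lamE j : 8 * (2 * n + 1 - 3)%:R * cos (freq R (2 * n + 1) j) = lam j.
  congr (_ * _ * _); rewrite -subnBA // natrB ?natrM //; lia.
have E : perm_eq (lanzhou_spectrum R (cycle_graph (2 * n + 1)))
                 [seq lam j | j <- index_iota 0 (2 * n + 1)].
  (* On both sides the count of [x] is its multiplicity as a root of the characteristic
     polynomial. *)
  apply/allP => x _ /=; apply/eqP.
  rewrite count_spectrum char_poly_lanzhou_cycle // -mu_prod_XsubC big_map big_mkord.
  by congr mup; apply: eq_bigr => j _; congr (_ - _%:P); apply: lamE.
rewrite (perm_trans E) // perm_sym /index_iota subn0.
(* Index [0] has cosine [1] and gives the eigenvalue listed first. *)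
have -> : iota 0 (2 * n + 1) = 0%N :: iota 1 (n + n).
  by rewrite -[RHS]/(iota 0 (n + n).+1); congr iota; lia.
rewrite /= {1}/lam /freq mulr0 mul0r cos0 mulr1 perm_cons.
apply: (perm_trans (perm_flatten_nseq2 _ _ lam (iota 1 n))); rewrite iotaD map_cat perm_cat2l.
(* The indices [n+1, ..., 2n] are [2n+1-j] for [j = n, ..., 1], so their values are those of
   [1, ..., n] read backwards. *)
rewrite -perm_rev.
suff -> : [seq lam i | i <- iota (1 + n) n] = rev [seq lam i | i <- iota 1 n].
  by rewrite perm_refl.
apply: (@eq_from_nth _ 0); rewrite ?size_rev !size_map !size_iota // => i ilt.
rewrite nth_rev size_map size_iota // !(nth_map 0%N) ?size_iota ?nth_iota; try lia.
rewrite /lam -(@cos_freq_rev R _ (1 + (n - i.+1))); try lia.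
by congr (_ * cos (freq _ _ _)); lia.
Qed.
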